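(* For every positive integer $d$ and every real $\epsilon>0$, there is a $K\in\mathbb{N}$ such that the following holds. Let $(X,\mathcal{B},\mu)$ be a probability measure space, let $T_1,\ldots,T_d:X\to X$ be pairwise commuting, invertible, measurable, measure-preserving transformations (with measurable inverses), and let $f_1,\ldots,f_d:X\to\mathbb{R}$ be measurable functions with $\|f_i\|_{L^\infty}\le 1$ for each $i$. Then whenever $N_1<N_2<\cdots<N_K$ are positive integers, there is an $i$ with $1\le i<K$ such that \[\left\|\frac{1}{N_i}\sum_{n=1}^{N_i}(f_1\circ T_1^n)\cdots(f_d\circ T_d^n)-\frac{1}{N_{i+1}}\sum_{n=1}^{N_{i+1}}(f_1\circ T_1^n)\cdots(f_d\circ T_d^n)\right\|_{L^2(\mu)}<\epsilon.\]
   Context: Products of functions are pointwise, and $T_i^n$ denotes the $n$-fold iterate of $T_i$. The bound $K$ depends only on $d$ and $\epsilon$, not on the probability space, the transformations, or the functions. *)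

(* Defs.v *)
From mathcomp Require Import all_boot all_order all_algebra.
From mathcomp Require Import all_classical all_reals all_analysis.

Set Implicit Arguments.
Unset Strict Implicit.
Unset Printing Implicit Defensive.

Import Order.TTheory GRing.Theory Num.Theory.

Local Open Scope classical_set_scope.
Local Open Scope ring_scope.

Definition measure_preserving {disp : measure_display}
    {X : measurableType disp} {R : realType}
    (mu : {measure set X -> \bar R}) (T : X -> X) : Prop :=
  measurable_fun [set: X] T /\
  forall A : set X, measurable A -> mu (T @^-1` A) = mu A.

Definition measurably_invertible {disp : measure_display}
    {X : measurableType disp} (T : X -> X) : Prop :=
  exists S : X -> X,
    [/\ cancel T S, cancel S T & measurable_fun [set: X] S].

Definition multiple_average {X : Type} {R : realType} {d : nat}
    (T : 'I_d -> X -> X) (f : 'I_d -> X -> R) (N : nat) : X -> R :=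
  fun x => N%:R^-1 *
    \sum_(1 <= n < N.+1) \prod_(i < d) f i (iter n (T i) x).

(* Main.v *)
Require Import Defs.
From mathcomp Require Import all_boot all_order all_algebra.
From mathcomp Require Import all_classical all_reals all_analysis.
From mathcomp Require Import measurable_realfun ess_sup_inf ring lra.

(* Induction on d, proving for A_N = N^-1 sum_(n <= N) prod_i f_i o T_i^n and
   a_0 <= b_0 <= a_1 <= b_1 <= ... the uniform bound
     sum_(k < J) E (A_(a_k) - A_(b_k))^2 <= C(eps) + eps J.
   Write A_N = B_N f with f the last function, and put
   u_k = (B_(a_k) - B_(b_k)) f, sigma_k = (B_(a_k)^* - B_(b_k)^* ) u_k.
   The sum to bound is <f, sum_k sigma_k>, so its square is at most
   || sum_k sigma_k ||^2, and it suffices that the cross terms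
   <sigma_i, sigma_j> = <u_i, (B_(a_i) - B_(b_i)) sigma_j> are small on average
   over i < j.  Since B_N^* v is itself an average along the last
   transformation, B_M B_N^* v is, up to O(M/N), an average over k <= N of
   bounded multiples of averages A_M of d - 1 transformations, so the induction
   hypothesis on the space X * {1, ..., N} applies.  As u_i = O((b_i - a_i)/b_i)
   pointwise, the total error is at most a multiple of
   sum_(i < j) (b_i - a_i) / a_j <= 1, which telescopes: no lacunarity of the
   sequence is needed. *)

Import Order.TTheory GRing.Theory Num.Theory.

Local Open Scope classical_set_scope.
Local Open Scope ring_scope.

(** * Elementary estimates for averages and shifted sums *)

Lemma norm_cesaro_le (R : realType) (G : nat -> R) (N : nat) (c : R) :
  0 <= c -> (forall n, (0 < n <= N)%N -> `|G n| <= c) ->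
  `|N%:R^-1 * \sum_(1 <= n < N.+1) G n| <= c.
Proof.
move=> c0 Gc; have [->|N0] := posnP N; first by rewrite invr0 mul0r normr0.
rewrite normrM ger0_norm ?invr_ge0 // ler_pdivrMl ?ltr0n //.
apply: le_trans (ler_norm_sum _ _ _) _.
apply: (@le_trans _ _ (\sum_(1 <= n < N.+1) c)); first exact: ler_sum_nat.
by rewrite sumr_const_nat subn1 mulr_natl.
Qed.

Lemma norm_sum_nat_le (R : realType) (G : nat -> R) (m n : nat) (c : R) :
  (forall k, `|G k| <= c) -> `|\sum_(m <= k < n) G k| <= c * (n - m)%:R.
Proof.
move=> Gc; apply: le_trans (ler_norm_sum _ _ _) _.
apply: (le_trans (ler_sum _ (fun n _ => Gc n))).
by rewrite sumr_const_nat mulr_natr.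
Qed.

(** Splitting at [a], the difference is [(b - a) / b] times the average up to [a], minus [b^-1]
    times the sum of the [b - a] new terms. The relative gap [(b - a) / b], rather than a mere
    constant, is what later makes the errors telescope. *)
Lemma norm_cesaro_sub_le (R : realType) (G : nat -> R) (a b : nat) (c : R) :
  (0 < a)%N -> (a <= b)%N -> (forall n, `|G n| <= c) ->
  `|a%:R^-1 * \sum_(1 <= n < a.+1) G n - b%:R^-1 * \sum_(1 <= n < b.+1) G n|
    <= 2 * c * ((b%:R - a%:R) / b%:R).
Proof.
move=> a0 ab Gc.
have b0 : (0 < b)%N := leq_trans a0 ab.
rewrite (big_cat_nat (n := a.+1) (p := b.+1)) //=.
have := norm_sum_nat_le R G 1 a.+1 c Gc; rewrite subn1 /=.
have := norm_sum_nat_le R G a.+1 b.+1 c Gc; rewrite subSS natrB //.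
move: (\sum_(_ <= _ < a.+1) _) (\sum_(_ <= _ < _) _) => s r hr hs.
have aR : (0 : R) < a%:R by rewrite ltr0n.
have bR : (0 : R) < b%:R by rewrite ltr0n.
have abR : (a%:R : R) <= b%:R by rewrite ler_nat.
have -> : a%:R^-1 * s - b%:R^-1 * (s + r) =
    (b%:R - a%:R) / b%:R * (s / a%:R) - r / b%:R.
  by field; rewrite !gt_eqF.
apply: le_trans (ler_normB _ _) _.
rewrite (_ : 2 * c * _ = c * ((b%:R - a%:R) / b%:R) + c * ((b%:R - a%:R) / b%:R));
  last by rewrite -mulrA mulr_natl mulr2n.
apply: lerD.
  rewrite normrM ger0_norm; last by rewrite divr_ge0 ?subr_ge0 // ltW.
  rewrite mulrC.
  apply: ler_wpM2r; first by rewrite divr_ge0 ?subr_ge0 // ltW.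
  by rewrite normrM normfV (gtr0_norm aR) ler_pdivrMr.
by rewrite normrM normfV (gtr0_norm bR) mulrA ler_pM2r ?invr_gt0.
Qed.

Lemma norm_sum_shift_le (R : realType) (G : nat -> R) (N m : nat) (c : R) :
  (forall n, `|G n| <= c) ->
  `|\sum_(1 <= n < N.+1) G n - \sum_(1 <= k < N.+1) G (k + m)%N|
    <= 2 * c * m%:R.
Proof.
move=> Gc.
have -> : \sum_(1 <= k < N.+1) G (k + m)%N =
    \sum_(1 + m <= n < N.+1 + m) G n by rewrite big_addn addnK.
have -> : \sum_(1 <= n < N.+1) G n - \sum_(1 + m <= n < N.+1 + m) G n =
    \sum_(1 <= n < 1 + m) G n - \sum_(N.+1 <= n < N.+1 + m) G n.
  (* Both sides come from splitting the sum over [1 <= n < N.+1 + m], once at [N.+1] and once at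
     [1 + m]; the identity therefore also holds for [m > N]. *)
  apply/eqP; rewrite subr_eq addrAC eq_sym subr_eq -!big_cat_nat //=.
  - by rewrite addSn ltnS leq_addr.
  - by rewrite leq_add2r.
have := norm_sum_nat_le R G 1 (1 + m) c Gc; rewrite addKn.
have := norm_sum_nat_le R G N.+1 (N.+1 + m) c Gc; rewrite addKn.
have := ler_normB (\sum_(1 <= n < 1 + m) G n) (\sum_(N.+1 <= n < N.+1 + m) G n).
lra.
Qed.

(* [dom] plays the role of the bounded measurable functions. *)
Record bounded_mean (R : realType) (X : Type) := BoundedMean {
  dom : (X -> R) -> Prop;
  mean : (X -> R) -> R;
  dom_cst : forall c, dom (fun=> c);
  domD : forall f g, dom f -> dom g -> dom (fun x => f x + g x);
  domM : forall f g, dom f -> dom g -> dom (fun x => f x * g x);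
  mean1 : mean (fun=> 1) = 1;
  meanD : forall f g, dom f -> dom g ->
    mean (fun x => f x + g x) = mean f + mean g;
  meanZ : forall c f, dom f -> mean (fun x => c * f x) = c * mean f;
  mean_ge0 : forall f, dom f -> (forall x, 0 <= f x) -> 0 <= mean f }.
Arguments dom {R X}.
Arguments mean {R X}.
Arguments dom_cst {R X}.
Arguments domD {R X} _ {f g}.
Arguments domM {R X} _ {f g}.
Arguments mean1 {R X}.
Arguments meanD {R X} _ {f g}.
Arguments meanZ {R X} _ c {f}.
Arguments mean_ge0 {R X} _ {f}.

(** * Positive functionals on bounded functions, and maps preserving them *)

Section BoundedMeanTheory.
Context {R : realType} {X : Type} (E : bounded_mean R X).

Lemma domZ c f : dom E f -> dom E (fun x => c * f x).
Proof. by apply: domM; exact: dom_cst. Qed.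

Lemma domB f g : dom E f -> dom E g -> dom E (fun x => f x - g x).
Proof.
move=> Df Dg; rewrite (_ : (fun x => _) = (fun x => f x + -1 * g x)).
  by apply: domD => //; exact: domZ.
by apply/funext => x; rewrite mulN1r.
Qed.

Lemma meanB f g : dom E f -> dom E g ->
  mean E (fun x => f x - g x) = mean E f - mean E g.
Proof.
move=> Df Dg; rewrite (_ : (fun x => _ - _) = (fun x => f x + -1 * g x)).
  by rewrite meanD ?meanZ ?mulN1r //; exact: domZ.
by apply/funext => x; rewrite mulN1r.
Qed.

Lemma mean_cst c : mean E (fun=> c) = c.
Proof.
rewrite -[RHS]mulr1 -(mean1 E) -meanZ; last exact: dom_cst.
by congr mean; apply/funext => x; rewrite mulr1.
Qed.

Lemma le_mean f g : dom E f -> dom E g -> (forall x, f x <= g x) ->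
  mean E f <= mean E g.
Proof.
move=> Df Dg fg; rewrite -subr_ge0 -meanB //.
by apply: mean_ge0 => [|x]; [exact: domB|rewrite subr_ge0].
Qed.

Lemma dom_sum (m n : nat) (G : nat -> X -> R) : (forall k, dom E (G k)) ->
  dom E (fun x => \sum_(m <= k < n) G k x).
Proof.
move=> DG; have [nm|] := leqP n m.
  rewrite (_ : (fun x => _) = fun=> 0); first exact: dom_cst.
  by apply/funext => x; rewrite big_geq.
elim: n => // n IH mn; rewrite (_ : (fun x => _) =
    (fun x => \sum_(m <= k < n) G k x + G n x)); last first.
  by apply/funext => x; rewrite big_nat_recr.
apply: domD => //; have [nm|/IH//] := leqP n m.
rewrite (_ : (fun x => _) = fun=> 0); first exact: dom_cst.
by apply/funext => x; rewrite big_geq.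
Qed.

Lemma mean_sum (m n : nat) (G : nat -> X -> R) : (forall k, dom E (G k)) ->
  mean E (fun x => \sum_(m <= k < n) G k x) = \sum_(m <= k < n) mean E (G k).
Proof.
move=> DG; elim: n => [|n IH].
  rewrite big_geq // -[RHS](mean_cst 0); congr mean.
  by apply/funext => x; rewrite big_geq.
have [mn|nm] := leqP m n; last first.
  rewrite big_geq // -[RHS](mean_cst 0); congr mean.
  by apply/funext => x; rewrite big_geq.
rewrite big_nat_recr //= -IH -meanD //; last exact: dom_sum.
by congr mean; apply/funext => x; rewrite big_nat_recr.
Qed.

Lemma dom_prod (d : nat) (G : 'I_d -> X -> R) : (forall i, dom E (G i)) ->
  dom E (fun x => \prod_(i < d) G i x).
Proof.
elim: d G => [|d IH] G DG.
  rewrite (_ : (fun x => _) = fun=> 1); first exact: dom_cst.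
  by apply/funext => x; rewrite big_ord0.
rewrite (_ : (fun x => _) = fun x =>
    (\prod_(i < d) G (widen_ord (leqnSn d) i) x) * G ord_max x); last first.
  by apply/funext => x; rewrite big_ord_recr.
by apply: domM => //; apply: IH.
Qed.

Definition preserves (T : X -> X) := forall f, dom E f ->
  dom E (f \o T) /\ mean E (f \o T) = mean E f.

Definition automorphism (T S : X -> X) :=
  [/\ cancel T S, cancel S T, preserves T & preserves S].

Lemma preserves_iter T n : preserves T -> preserves (iter n T).
Proof.
move=> pT; elim: n => [//|n IH] f Df.
have [Df1 Ef1] := pT f Df; have [Df2 Ef2] := IH _ Df1.
by split; [exact: Df2|rewrite -Ef1 -Ef2].
Qed.

(** Cauchy-Schwarz: with [t = E (f s)], the bound [|f| <= 1] gives [0 <= E (t f - s)^2 <= t^2 - 2 t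
    E (f s) + E s^2 = E s^2 - t^2]. *)
Lemma mean_square_le (f s : X -> R) : dom E f -> dom E s ->
  (forall x, `|f x| <= 1) ->
  mean E (fun x => f x * s x) ^+ 2 <= mean E (fun x => s x * s x).
Proof.
move=> Df Ds f1; set t := mean E (fun x => f x * s x).
have Dff := domM E Df Df; have Dss := domM E Ds Ds.
have Dfs := domM E Df Ds.
have : 0 <= mean E (fun x => (t ^+ 2 - 2 * t * (f x * s x)) + s x * s x).
  apply: mean_ge0.
    by apply: domD => //; apply: domB; [exact: dom_cst|exact: domZ].
  move=> x; have f2 : f x ^+ 2 <= 1 by rewrite -real_normK ?num_real // expr_le1.
  have : 0 <= t ^+ 2 * (1 - f x ^+ 2) by rewrite mulr_ge0 ?sqr_ge0 // subr_ge0.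
  have : 0 <= (t * f x - s x) ^+ 2 by exact: sqr_ge0.
  lra.
rewrite meanD // ?meanB ?meanZ ?mean_cst //; first by rewrite -/t; lra.
all: by do ?[exact: dom_cst|exact: domZ|apply: domB].
Qed.

End BoundedMeanTheory.

(** * The uniform mean over [N] copies of the space *)

Section AveragedMean.
Context {R : realType} {X : Type} (E : bounded_mean R X).
Variables (N : nat) (N_gt0 : (0 < N)%N).

(* Points [(x, k)] with [k] outside [1, N] are junk: they carry no weight. *)
Let adom (G : X * nat -> R) := forall k, dom E (fun x => G (x, k)).
Let amean (G : X * nat -> R) :=
  N%:R^-1 * \sum_(1 <= k < N.+1) mean E (fun x => G (x, k)).

Let adomD G H : adom G -> adom H -> adom (fun p => G p + H p).
Proof. by move=> DG DH k; exact: domD. Qed.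

Let adomM G H : adom G -> adom H -> adom (fun p => G p * H p).
Proof. by move=> DG DH k; exact: domM. Qed.

Let amean1 : amean (fun=> 1) = 1.
Proof.
rewrite /amean mean1 sumr_const_nat subn1 /= mulVf //.
by rewrite pnatr_eq0 -lt0n.
Qed.

Let ameanD G H : adom G -> adom H ->
  amean (fun p => G p + H p) = amean G + amean H.
Proof.
move=> DG DH; rewrite /amean -mulrDr -big_split /=; congr (_ * _).
by apply: eq_bigr => k _; exact: meanD.
Qed.

Let ameanZ c G : adom G -> amean (fun p => c * G p) = c * amean G.
Proof.
move=> DG; rewrite /amean mulrCA; congr (_ * _); rewrite mulr_sumr.
by apply: eq_bigr => k _; exact: meanZ.
Qed.

Let amean_ge0 G : adom G -> (forall p, 0 <= G p) -> 0 <= amean G.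
Proof.
move=> DG G0; rewrite mulr_ge0 ?invr_ge0 // sumr_ge0 // => k _.
exact: mean_ge0.
Qed.

(** The mean on [X * {1, ..., N}] of the overview. For an abstract functional this is just a finite
    average, with no product measure to construct; indexing the copies by [nat] keeps the type
    independent of [N]. *)
Definition averaged_mean : bounded_mean R (X * nat) :=
  @BoundedMean R (X * nat) adom amean (fun c k => dom_cst E c)
    adomD adomM amean1 ameanD ameanZ amean_ge0.

Lemma dom_averaged G : (forall k, dom E (fun x => G (x, k))) ->
  dom averaged_mean G.
Proof. by []. Qed.

Lemma automorphism_averaged (T S : X -> X) : automorphism E T S ->
  automorphism averaged_mean
    (fun p => (T p.1, p.2)) (fun p => (S p.1, p.2)).
Proof.
move=> [TS ST pT pS]; split.
- by case=> x k; rewrite /= TS.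
- by case=> x k; rewrite /= ST.
- move=> G DG; split; first by move=> k; exact: (pT _ (DG k)).1.
  by rewrite /= /amean; congr (_ * _); apply: eq_bigr => k _; exact: (pT _ (DG k)).2.
- move=> G DG; split; first by move=> k; exact: (pS _ (DG k)).1.
  by rewrite /= /amean; congr (_ * _); apply: eq_bigr => k _; exact: (pS _ (DG k)).2.
Qed.

End AveragedMean.

(** * Weighted averages along one transformation, and their adjoints *)

Section WeightedAverages.
Context {R : realType} {X : Type} (E : bounded_mean R X).
Variables (F : nat -> X -> R) (t s : X -> X).
Hypothesis ts : automorphism E t s.
Hypothesis F_dom : forall n, dom E (F n).
Hypothesis F_le1 : forall n x, `|F n x| <= 1.

(** The operator [B_N] of the overview; in the induction step [F n] is the product of all factors
    but the last. *)
Definition weighted_average (N : nat) (g : X -> R) (x : X) : R :=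
  N%:R^-1 * \sum_(1 <= n < N.+1) F n x * g (iter n t x).

Definition adjoint_average (N : nat) (u : X -> R) (x : X) : R :=
  N%:R^-1 * \sum_(1 <= n < N.+1) F n (iter n s x) * u (iter n s x).

Let dom_t n f : dom E f -> dom E (fun x => f (iter n t x)).
Proof. by case: ts => _ _ pt _ /(preserves_iter E t n pt)[]. Qed.

Let dom_s n f : dom E f -> dom E (fun x => f (iter n s x)).
Proof. by case: ts => _ _ _ ps /(preserves_iter E s n ps)[]. Qed.

Lemma iter_cancel n : cancel (iter n t) (iter n s).
Proof.
case: ts => tK _ _ _; elim: n => // n IH x.
by rewrite iterSr iterS tK IH.
Qed.

Lemma iter_cancelV n : cancel (iter n s) (iter n t).
Proof.
case: ts => _ sK _ _; elim: n => // n IH x.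
by rewrite iterSr iterS sK IH.
Qed.

Lemma dom_weighted_average N g : dom E g -> dom E (weighted_average N g).
Proof.
move=> Dg; rewrite /weighted_average; apply: domZ; apply: dom_sum => n.
by apply: domM => //; exact: dom_t.
Qed.

Lemma dom_adjoint_average N u : dom E u -> dom E (adjoint_average N u).
Proof.
move=> Du; rewrite /adjoint_average; apply: domZ; apply: dom_sum => n.
by apply: (dom_s n (fun y => F n y * u y)); exact: domM.
Qed.

Lemma norm_adjoint_average N u c : (forall x, `|u x| <= c) ->
  forall x, `|adjoint_average N u x| <= c.
Proof.
move=> uc x; have c0 : 0 <= c := le_trans (normr_ge0 _) (uc x).
apply: norm_cesaro_le => // n _.
by rewrite normrM -[c]mul1r ler_pM.
Qed.

(** Composing the [n]-th term with [iter n s], which preserves the mean, frees [g] from [iter n t]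
    and moves [F n * u] by [s] instead; so [adjoint_average] is [B_N^*]. *)
Lemma mean_adjoint N g u : dom E g -> dom E u ->
  mean E (fun x => weighted_average N g x * u x) =
  mean E (fun x => g x * adjoint_average N u x).
Proof.
move=> Dg Du; pose G n x := F n x * g (iter n t x) * u x.
pose H n x := g x * (F n (iter n s x) * u (iter n s x)).
have DG n : dom E (G n).
  by apply: domM => //; apply: domM => //; exact: dom_t.
have DH n : dom E (H n).
  by apply: domM => //; apply: (dom_s n (fun y => F n y * u y)); exact: domM.
transitivity (mean E (fun x => N%:R^-1 * \sum_(1 <= n < N.+1) G n x)).
  by congr mean; apply/funext => x; rewrite /weighted_average -mulrA mulr_suml.
transitivity (mean E (fun x => N%:R^-1 * \sum_(1 <= n < N.+1) H n x)); last first.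
  congr mean; apply/funext => x.
  by rewrite /adjoint_average [RHS]mulrCA; congr (_ * _); rewrite mulr_sumr.
rewrite !meanZ ?mean_sum //; try exact: dom_sum.
congr (_ * _); apply: eq_bigr => n _.
case: ts => _ _ _ ps; rewrite -(preserves_iter E s n ps _ (DG n)).2.
congr mean; apply/funext => x; rewrite /G /H /= iter_cancelV; ring.
Qed.

(* Reindex [n = k + m] in [adjoint_average]: at most [m] boundary terms
   on each side change. *)
Lemma weighted_average_adjoint M N u c x :
  (0 < M)%N -> (0 < N)%N -> (forall y, `|u y| <= c) ->
  `|weighted_average M (adjoint_average N u) x -
    N%:R^-1 * \sum_(1 <= k < N.+1) u (iter k s x) *
      (M%:R^-1 * \sum_(1 <= m < M.+1) F m x * F (k + m)%N (iter k s x))|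
  <= 2 * c * (M%:R / N%:R).
Proof.
move=> M0 N0 uc; have c0 : 0 <= c := le_trans (normr_ge0 _) (uc x).
have NR : (0 : R) < N%:R by rewrite ltr0n.
(* [G m n] is the [n]-th term of [B_N^* u] at [iter m t x]. For [n = k + m] the [m] steps of [t] are
   undone, leaving [iter k s x]. *)
pose G m n := F n (iter n s (iter m t x)) * u (iter n s (iter m t x)).
have Gc m n : `|G m n| <= c by rewrite normrM -[c]mul1r ler_pM.
have GE m k : G m (k + m)%N = F (k + m)%N (iter k s x) * u (iter k s x).
  by rewrite /G iterD iter_cancel.
have -> : N%:R^-1 * \sum_(1 <= k < N.+1) u (iter k s x) *
      (M%:R^-1 * \sum_(1 <= m < M.+1) F m x * F (k + m)%N (iter k s x)) =
    M%:R^-1 * \sum_(1 <= m < M.+1) F m x *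
      (N%:R^-1 * \sum_(1 <= k < N.+1) G m (k + m)%N).
  under eq_bigr do rewrite mulrCA mulr_sumr.
  under [in RHS]eq_bigr do rewrite mulrCA mulr_sumr.
  rewrite -!mulr_sumr mulrCA exchange_big /=; congr (_ * (_ * _)).
  by apply: eq_bigr => m _; apply: eq_bigr => k _; rewrite GE; ring.
rewrite /weighted_average /adjoint_average -mulrBr -sumrB.
apply: norm_cesaro_le => [|m /andP[_ mM]].
  by rewrite mulr_ge0 ?divr_ge0 ?mulr_ge0.
rewrite -mulrBr -mulrBr normrM -[leRHS]mul1r ler_pM // normrM.
rewrite ger0_norm ?invr_ge0 // ler_pdivrMl //.
rewrite (_ : N%:R * _ = 2 * c * M%:R); last by field; rewrite gt_eqF.
apply: le_trans (norm_sum_shift_le R (G m) N m c (Gc m)) _.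
by rewrite ler_wpM2l ?mulr_ge0 // ler_nat.
Qed.

End WeightedAverages.

(** * Commuting systems and the uniform oscillation bound *)

Record commuting_system {R : realType} {X : Type} {d : nat}
    (E : bounded_mean R X) (T S : 'I_d -> X -> X) (f : 'I_d -> X -> R) : Prop := {
  system_automorphism : forall i, automorphism E (T i) (S i);
  system_commute : forall i j x, T i (T j x) = T j (T i x);
  system_dom : forall i, dom E (f i);
  system_le1 : forall i x, `|f i x| <= 1 }.
Arguments system_automorphism {R X d E T S f}.
Arguments system_commute {R X d E T S f}.
Arguments system_dom {R X d E T S f}.
Arguments system_le1 {R X d E T S f}.

(** [C] is chosen before the space, the functional and the sequences: the induction step needs one
    constant for all the spaces [X * nat], with [N] arbitrarily large. The intervals [[a k, b k]]
    may share endpoints or be degenerate. *)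
Definition bounded_oscillation (R : realType) (d : nat) : Prop :=
  forall eps : R, 0 < eps -> exists C : R,
  forall (X : Type) (E : bounded_mean R X) (T S : 'I_d -> X -> X)
    (f : 'I_d -> X -> R), commuting_system E T S f ->
  forall a b : nat -> nat, (forall k, 0 < a k)%N ->
  (forall k, a k <= b k)%N -> (forall k, b k <= a k.+1)%N ->
  forall J : nat,
    \sum_(0 <= k < J) mean E (fun x =>
      (multiple_average T f (a k) x - multiple_average T f (b k) x) ^+ 2)
    <= C + eps * J%:R.

Lemma norm_prod_le1 (R : realType) (d : nat) (G : 'I_d -> R) :
  (forall i, `|G i| <= 1) -> `|\prod_(i < d) G i| <= 1.
Proof.
by move=> G1; rewrite normr_prod; apply: prodr_ile1 => i _; rewrite normr_ge0 G1.
Qed.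

Section System.
Context {R : realType} {X : Type} {d : nat} {E : bounded_mean R X}.
Context {T S : 'I_d -> X -> X} {f : 'I_d -> X -> R}.
Hypothesis sys : commuting_system E T S f.

Lemma dom_system_iter i n g : dom E g -> dom E (fun x => g (iter n (T i) x)).
Proof.
by case: (system_automorphism sys i) => _ _ pt _ /(preserves_iter E _ n pt)[].
Qed.

Lemma dom_multiple_average N : dom E (multiple_average T f N).
Proof.
rewrite /multiple_average; apply: domZ; apply: dom_sum => n.
by apply: dom_prod => i; apply: dom_system_iter; exact: system_dom sys i.
Qed.

Lemma multiple_average_sub_le a b x : (0 < a)%N -> (a <= b)%N ->
  `|multiple_average T f a x - multiple_average T f b x|
    <= 2 * ((b%:R - a%:R) / b%:R).
Proof.
move=> a0 ab; rewrite -[2 in leRHS]mulr1; apply: norm_cesaro_sub_le => // n.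
by apply: norm_prod_le1 => i; exact: system_le1 sys _ _.
Qed.

Lemma multiple_average_sub_le2 a b x : (0 < a)%N -> (a <= b)%N ->
  `|multiple_average T f a x - multiple_average T f b x| <= 2.
Proof.
move=> a0 ab; apply: (le_trans (multiple_average_sub_le a b x a0 ab)).
rewrite -[leRHS]mulr1 ler_wpM2l // ler_pdivrMr ?ltr0n ?(leq_trans a0) // mul1r.
by rewrite gerBl.
Qed.

Lemma commute_iter i j m n x :
  iter m (T i) (iter n (T j) x) = iter n (T j) (iter m (T i) x).
Proof.
have c1 k y : iter k (T i) (T j y) = T j (iter k (T i) y).
  by elim: k => // k IH; rewrite !iterS IH (system_commute sys).
by elim: n => // n IH; rewrite !iterS c1 IH.
Qed.

(** Applying the injective map [iter n (T j)] to both sides reduces this to [commute_iter]. *)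
Lemma commute_iterV i j m n x :
  iter m (T i) (iter n (S j) x) = iter n (S j) (iter m (T i) x).
Proof.
have tsj := system_automorphism sys j.
apply: (can_inj (iter_cancel E (T j) (S j) tsj n)).
by rewrite -(commute_iter i j) !(iter_cancelV E (T j) (S j) tsj n).
Qed.

End System.

(** * The induction step, from [d] to [d + 1] transformations *)

Section InductionStep.
Context {R : realType} {X : Type} {d : nat} {E : bounded_mean R X}.
Context {T S : 'I_d.+1 -> X -> X} {f : 'I_d.+1 -> X -> R}.
Hypothesis sys : commuting_system E T S f.

Let w (i : 'I_d) : 'I_d.+1 := widen_ord (leqnSn d) i.
Let t := T ord_max.
Let s := S ord_max.
Let F n x := \prod_(i < d) f (w i) (iter n (T (w i)) x).

Let ts : automorphism E t s := system_automorphism sys ord_max.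

Let F_dom n : dom E (F n).
Proof.
by apply: dom_prod => i; apply: dom_system_iter sys _ _ _ _; exact: system_dom sys _.
Qed.

Let F_le1 n x : `|F n x| <= 1.
Proof. by apply: norm_prod_le1 => i; exact: system_le1 sys _ _. Qed.

Lemma multiple_average_weighted N :
  multiple_average T f N = weighted_average F t N (f ord_max).
Proof.
apply/funext => x; congr (_ * _); apply: eq_bigr => n _.
by rewrite big_ord_recr.
Qed.

(** The first [d] transformations act on each copy of [X] and fix its index. Carrying the shift [k]
    as a coordinate turns the average over [k] into a single mean, so one system of [d]
    transformations handles all shifts at once. *)
Definition reduced_T (i : 'I_d) (p : X * nat) := (T (w i) p.1, p.2).
Definition reduced_S (i : 'I_d) (p : X * nat) := (S (w i) p.1, p.2).
(* [f_i * (f_i o T_i^k o t^-k)] on the [k]-th copy of [X], [t] the last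
   transformation. *)
Definition reduced_f (i : 'I_d) (p : X * nat) : R :=
  f (w i) p.1 * f (w i) (iter p.2 (T (w i)) (iter p.2 s p.1)).

Lemma reduced_system (N : nat) (N_gt0 : (0 < N)%N) :
  commuting_system (averaged_mean E N N_gt0) reduced_T reduced_S reduced_f.
Proof.
split.
- by move=> i; apply: automorphism_averaged; exact: system_automorphism sys _.
- by move=> i j [x k]; rewrite /reduced_T /= (system_commute sys).
- move=> i; apply: dom_averaged => k; rewrite /reduced_f.
  apply: domM; first exact: system_dom sys _.
  have [_ _ _ ps] := ts.
  apply: (preserves_iter E s k ps (fun y => f (w i) (iter k (T (w i)) y)) _).1.
  by apply: dom_system_iter sys _ _ _ _; exact: system_dom sys _.
- by move=> i p; rewrite normrM mulr_ile1 // (system_le1 sys).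
Qed.

Let A N := multiple_average T f N.
Let A' N := multiple_average reduced_T reduced_f N.

(** Commutativity enters here: [T_i^(k + m) t^-k = T_i^k t^-k T_i^m], so the two factors containing
    [f_i] combine into [reduced_f i] at the [m]-th iterate. *)
Lemma reduced_average M k x :
  M%:R^-1 * \sum_(1 <= m < M.+1) F m x * F (k + m)%N (iter k s x) =
  A' M (x, k).
Proof.
congr (_ * _); apply: eq_bigr => m _; rewrite -big_split /=.
apply: eq_bigr => i _.
have -> : iter m (reduced_T i) (x, k) = (iter m (T (w i)) x, k).
  by elim: m => // m IH; rewrite !iterS IH.
rewrite /reduced_f /=; congr (_ * f _ _).
by rewrite iterD [iter m _ (iter k s x)](commute_iterV sys).
Qed.

(** [weighted_average_adjoint] replaces each [B_M B_N^* v] by an average over the copies of bounded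
    multiples of [A' M]; the small factor [A a - A b] compensates the error of the replacement. *)
Lemma correlation_le a b N (N_gt0 : (0 < N)%N) v eta :
  (0 < a)%N -> (a <= b)%N -> dom E v -> (forall x, `|v x| <= 2) -> 0 < eta ->
  mean E (fun x => (A a x - A b x) *
    (weighted_average F t a (adjoint_average F s N v) x -
     weighted_average F t b (adjoint_average F s N v) x))
  <= 2 * eta + 16 * ((b%:R - a%:R) / N%:R) +
     2 / eta * mean (averaged_mean E N N_gt0) (fun p => (A' a p - A' b p) ^+ 2).
Proof.
move=> a0 ab Dv v2 eta0; have b0 := leq_trans a0 ab.
have bR : (0 : R) < b%:R by rewrite ltr0n.
have NR : (0 : R) < N%:R by rewrite ltr0n.
have abR : (a%:R : R) <= b%:R by rewrite ler_nat.
have sys' := reduced_system N N_gt0.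
have DD : dom (averaged_mean E N N_gt0) (fun p => (A' a p - A' b p) ^+ 2).
  have D1 : dom (averaged_mean E N N_gt0) (fun p => A' a p - A' b p).
    by apply: domB; exact: dom_multiple_average sys' _.
  exact: (domM _ D1 D1).
pose c := 16 * ((b%:R - a%:R) / N%:R) : R.
pose Z p := 2 * eta + 2 / eta * (A' a p - A' b p) ^+ 2.
have DZ : dom (averaged_mean E N N_gt0) Z.
  by apply: domD; [exact: dom_cst|exact: domZ].
(* Written as a mean over [X] of a constant plus an average over the copies, the bound can be proved
   at each [x]. *)
have -> : 2 * eta + 16 * ((b%:R - a%:R) / N%:R) + 2 / eta *
    mean (averaged_mean E N N_gt0) (fun p => (A' a p - A' b p) ^+ 2) =
    mean E (fun x => c + N%:R^-1 * \sum_(1 <= k < N.+1) Z (x, k)).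
  rewrite meanD; [|exact: dom_cst|by apply: domZ; exact: dom_sum].
  rewrite mean_cst meanZ ?mean_sum //; last exact: dom_sum.
  rewrite -[X in _ = c + X]/(mean (averaged_mean E N N_gt0) Z) /Z.
  by rewrite meanD ?mean_cst ?meanZ // /c; [ring|exact: dom_cst|exact: domZ].
apply: le_mean => [| |x].
- apply: domM; first by apply: domB; exact: dom_multiple_average sys _.
  apply: domB; apply: (dom_weighted_average E F t s) => //.
    exact: (dom_adjoint_average E F t s).
  exact: (dom_adjoint_average E F t s).
- by apply: domD; [exact: dom_cst|apply: domZ; exact: dom_sum].
have := weighted_average_adjoint E F t s ts F_le1 a N v 2 x a0 N_gt0 v2.
have := weighted_average_adjoint E F t s ts F_le1 b N v 2 x b0 N_gt0 v2.
under eq_bigr do rewrite reduced_average.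
under [in X in _ -> X -> _]eq_bigr do rewrite reduced_average.
set wa := weighted_average _ _ a _ _; set wb := weighted_average _ _ b _ _.
set Sb := N%:R^-1 * _; set Sa := N%:R^-1 * _ => hb ha.
have u1 := multiple_average_sub_le sys a b x a0 ab.
have u2 := multiple_average_sub_le2 sys a b x a0 ab.
rewrite -/(A a) -/(A b) in u1 u2.
apply: le_trans (ler_norm _) _; rewrite normrM.
(* With [|v| <= 2] the two replacements cost [4 a / N] and [4 b / N]. *)
have wab : `|wa - wb| <= 8 * (b%:R / N%:R) + `|Sa - Sb|.
  have abN : (a%:R / N%:R : R) <= b%:R / N%:R by rewrite ler_pM2r ?invr_gt0.
  have -> : wa - wb = ((wa - Sa) - (wb - Sb)) + (Sa - Sb) by ring.
  apply: le_trans (ler_normD _ _) _; rewrite lerD2r.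
  by apply: le_trans (ler_normB _ _) _; lra.
apply: le_trans (ler_wpM2l (normr_ge0 _) wab) _.
rewrite mulrDr; apply: lerD.
  (* The denominator of [2 (b - a) / b] cancels the [b] of the error, leaving [16 (b - a) / N],
     which can be summed. *)
  apply: (@le_trans _ _ (2 * ((b%:R - a%:R) / b%:R) * (8 * (b%:R / N%:R)))).
    by rewrite ler_wpM2r // mulr_ge0 // divr_ge0.
  by rewrite /c le_eqVlt; apply/orP; left; apply/eqP; field; rewrite !gt_eqF.
apply: (@le_trans _ _ (2 * `|Sa - Sb|)); first by rewrite ler_wpM2r.
rewrite /Sa /Sb -mulrBr -sumrB normrM gtr0_norm ?invr_gt0 // mulrCA.
rewrite ler_pM2l ?invr_gt0 //.
apply: (@le_trans _ _ (2 * \sum_(1 <= k < N.+1) 2 * `|A' a (x, k) - A' b (x, k)|)).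
  rewrite ler_pM2l //; apply: le_trans (ler_norm_sum _ _ _) _.
  by apply: ler_sum => k _; rewrite -mulrBr normrM ler_wpM2r.
rewrite mulr_sumr; apply: ler_sum => k _; rewrite /Z.
set y := A' a _ - _; rewrite -(real_normK (num_real y)).
(* The inequality [4 |y| <= 2 eta + 2 y^2 / eta], as a completed square. *)
rewrite -subr_ge0 (_ : _ - _ = 2 / eta * (eta - `|y|) ^+ 2);
  last by field; rewrite gt_eqF.
by rewrite mulr_ge0 ?sqr_ge0 // divr_ge0 // ltW.
Qed.

(** The errors [16 (b i - a i) / N] sum to at most [16]: the intervals do not overlap and lie below
    [a j <= N]. The slope [eta^2] offsets the factor [2 / eta], so the linear terms are [2 eta j]
    twice. *)
Lemma sum_correlation_le (a b : nat -> nat) (C eta : R) (v : X -> R) (N j : nat) :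
  (forall k, 0 < a k)%N -> (forall k, a k <= b k)%N ->
  (forall k, b k <= a k.+1)%N -> (a j <= N)%N ->
  dom E v -> (forall x, `|v x| <= 2) -> 0 < eta ->
  (forall N_gt0 : (0 < N)%N,
    \sum_(0 <= k < j) mean (averaged_mean E N N_gt0)
      (fun p => (A' (a k) p - A' (b k) p) ^+ 2) <= C + eta ^+ 2 * j%:R) ->
  \sum_(0 <= i < j) mean E (fun x => (A (a i) x - A (b i) x) *
    (weighted_average F t (a i) (adjoint_average F s N v) x -
     weighted_average F t (b i) (adjoint_average F s N v) x))
  <= 2 / eta * C + 16 + 4 * eta * j%:R.
Proof.
move=> a0 ab ba ajN Dv v2 eta0 HC.
have N0 : (0 < N)%N := leq_trans (a0 j) ajN.
have NR : (0 : R) < N%:R by rewrite ltr0n.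
pose D k := mean (averaged_mean E N N0) (fun p => (A' (a k) p - A' (b k) p) ^+ 2).
apply: (@le_trans _ _ (\sum_(0 <= i < j) (2 * eta +
    16 * (((b i)%:R - (a i)%:R) / N%:R) + 2 / eta * D i))).
  by apply: ler_sum => i _; exact: correlation_le.
have HD : \sum_(0 <= k < j) D k <= C + eta ^+ 2 * j%:R := HC N0.
clearbody D.
rewrite !big_split /= sumr_const_nat subn0 -!mulr_sumr -mulr_suml -[_ *+ j]mulr_natr.
have tel : \sum_(0 <= i < j) ((b i)%:R - (a i)%:R) <= (N%:R : R).
  apply: (@le_trans _ _ (a j)%:R); last by rewrite ler_nat.
  elim: (j) => [|k IH]; first by rewrite big_geq.
  rewrite big_nat_recr //=; apply: (@le_trans _ _ (b k)%:R); last by rewrite ler_nat.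
  by rewrite addrCA gerDl subr_le0.
have tel' : (\sum_(0 <= i < j) ((b i)%:R - (a i)%:R)) / N%:R <= (1 : R).
  by rewrite ler_pdivrMr // mul1r.
have := ler_wpM2l (ltW (divr_gt0 (ltr0n R 2) eta0)) HD.
rewrite mulrDr (_ : 2 / eta * (eta ^+ 2 * j%:R) = 2 * eta * j%:R);
  last by field; rewrite gt_eqF.
lra.
Qed.

Let u a b x := A a x - A b x.
Let sigma a b x := adjoint_average F s a (u a b) x - adjoint_average F s b (u a b) x.

Let u_dom a b : dom E (u a b).
Proof. by apply: domB; exact: dom_multiple_average sys _. Qed.

Let sigma_dom a b : dom E (sigma a b).
Proof. by apply: domB; exact: dom_adjoint_average ts F_dom _ _ (u_dom a b). Qed.

Let mean_sigma a b g : dom E g ->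
  mean E (fun x => u a b x *
    (weighted_average F t a g x - weighted_average F t b g x)) =
  mean E (fun x => sigma a b x * g x).
Proof.
move=> Dg; have Du := u_dom a b.
have DW N := dom_weighted_average E F t s ts F_dom N g Dg.
have DA N := dom_adjoint_average E F t s ts F_dom N (u a b) Du.
have -> : (fun x => u a b x *
    (weighted_average F t a g x - weighted_average F t b g x)) =
  fun x => weighted_average F t a g x * u a b x - weighted_average F t b g x * u a b x.
  by apply/funext => x; ring.
have -> : (fun x => sigma a b x * g x) = fun x =>
    g x * adjoint_average F s a (u a b) x - g x * adjoint_average F s b (u a b) x.
  by apply/funext => x; rewrite /sigma; ring.
rewrite !meanB; try by [apply: domM].
by rewrite !(mean_adjoint E F t s ts F_dom).
Qed.

(** Induction on [J], expanding the square. The new diagonal term is at most [16], as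
    [|sigma| <= 2 + 2]; twice the cross term is at most [4 * (2 / eta * C + 16) + 16 * eta * J],
    whose last summand fits under the increment of [16 * eta * J^2]. *)
Let sum_sigma_le (a b : nat -> nat) (C eta : R) (J : nat) :
  (forall k, 0 < a k)%N -> (forall k, a k <= b k)%N ->
  (forall k, b k <= a k.+1)%N -> 0 < eta ->
  (forall N (N_gt0 : (0 < N)%N) j,
    \sum_(0 <= k < j) mean (averaged_mean E N N_gt0)
      (fun p => (A' (a k) p - A' (b k) p) ^+ 2) <= C + eta ^+ 2 * j%:R) ->
  mean E (fun x => (\sum_(0 <= k < J) sigma (a k) (b k) x) *
                   (\sum_(0 <= k < J) sigma (a k) (b k) x)) <=
  (16 + 4 * (2 / eta * C + 16)) * J%:R + 16 * eta * J%:R ^+ 2.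
Proof.
move=> a0 ab ba eta0 HC.
have b0 k : (0 < b k)%N := leq_trans (a0 k) (ab k).
elim: J => [|J IH].
  rewrite mulr0 expr0n mulr0 addr0 -[leRHS](mean_cst E).
  rewrite le_eqVlt; apply/orP; left; apply/eqP.
  by congr mean; apply/funext => x; rewrite big_geq ?mulr0.
pose Sg x := \sum_(0 <= k < J) sigma (a k) (b k) x.
pose sJ := sigma (a J) (b J).
have DS : dom E Sg by exact: dom_sum.
have DsJ : dom E sJ by exact: sigma_dom.
have -> : (fun x => (\sum_(0 <= k < J.+1) sigma (a k) (b k) x) *
                   (\sum_(0 <= k < J.+1) sigma (a k) (b k) x)) =
    fun x => Sg x * Sg x + 2 * (Sg x * sJ x) + sJ x * sJ x.
  by apply/funext => x; rewrite !big_nat_recr //= -/(Sg x) -/(sJ x); ring.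
have DSS : dom E (fun x => Sg x * Sg x) by exact: domM.
have DSs : dom E (fun x => Sg x * sJ x) by exact: domM.
have Dss : dom E (fun x => sJ x * sJ x) by exact: domM.
have D2 : dom E (fun x => 2 * (Sg x * sJ x)) by exact: domZ.
have D3 : dom E (fun x => Sg x * Sg x + 2 * (Sg x * sJ x)) by exact: domD.
rewrite (meanD _ D3 Dss) (meanD _ DSS D2) (meanZ _ _ DSs).
have uJ2 x : `|u (a J) (b J) x| <= 2 by exact: multiple_average_sub_le2 sys _ _ _ _ _.
have sJ16 : mean E (fun x => sJ x * sJ x) <= 16.
  rewrite -[leRHS](mean_cst E); apply: le_mean => // [|x]; first exact: dom_cst.
  have sJ4 : `|sJ x| <= 4.
    apply: le_trans (ler_normB _ _) _.
    have := norm_adjoint_average F s F_le1 (a J) _ 2 uJ2 x.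
    have := norm_adjoint_average F s F_le1 (b J) _ 2 uJ2 x.
    lra.
  rewrite -expr2 -(real_normK (num_real _)) (_ : 16 = 4 ^+ 2); last by ring.
  by rewrite lerXn2r ?nnegrE.
have DA N v : dom E v -> dom E (adjoint_average F s N v).
  exact: (dom_adjoint_average E F t s ts F_dom).
have key N v : (a J <= N)%N -> dom E v -> (forall x, `|v x| <= 2) ->
    \sum_(0 <= i < J) mean E (fun x => sigma (a i) (b i) x * adjoint_average F s N v x)
    <= 2 / eta * C + 16 + 4 * eta * J%:R.
  move=> aJN Dv v2; under eq_bigr do rewrite -(mean_sigma _ _ _ (DA N v Dv)).
  exact: sum_correlation_le.
have cross : mean E (fun x => Sg x * sJ x) <= 2 * (2 / eta * C + 16 + 4 * eta * J%:R).
  (* The new [sigma] is a sum of two terms [B_N^* v]: [N = a J] with [v = u], and [N = b J] with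
     [v = - u]. Moving the sign into [v] lets the one-sided bound [key] serve for both. *)
  have DNu : dom E (fun x => - u (a J) (b J) x).
    rewrite (_ : (fun x => _) = fun x => 0 - u (a J) (b J) x).
      by apply: domB; [exact: dom_cst|exact: u_dom].
    by apply/funext => x; rewrite sub0r.
  have -> : (fun x => Sg x * sJ x) = fun x => \sum_(0 <= i < J)
      (sigma (a i) (b i) x * adjoint_average F s (a J) (u (a J) (b J)) x +
       sigma (a i) (b i) x *
        adjoint_average F s (b J) (fun x => - u (a J) (b J) x) x).
    apply/funext => x; rewrite /Sg mulr_suml; apply: eq_bigr => i _.
    rewrite -mulrDr /sJ /sigma; congr (_ * (_ + _)).
    rewrite /adjoint_average -mulrN -sumrN; congr (_ * _).
    by apply: eq_bigr => n _; rewrite mulrN.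
  have DsA i N v : dom E v ->
      dom E (fun x => sigma (a i) (b i) x * adjoint_average F s N v x).
    by move=> Dv; apply: domM; [exact: sigma_dom|exact: DA].
  rewrite mean_sum; last by move=> i; apply: domD; apply: DsA.
  under eq_bigr do rewrite (meanD _ (DsA _ _ _ (u_dom _ _)) (DsA _ _ _ DNu)).
  rewrite big_split /= mulr_natl mulr2n; apply: lerD; apply: key => //.
  by move=> x; rewrite normrN.
have eJ : 0 <= eta * J%:R by rewrite mulr_ge0 // ltW.
rewrite -[J.+1]addn1 natrD; lra.
Qed.

(** For [eta = eps^2 / 16] the quadratic term [16 eta J^2] is [(eps J)^2]. Cauchy-Schwarz then
    bounds the sum [W] by [W^2 <= c J + (eps J)^2 <= (c / eps + eps J)^2]. *)
Lemma oscillation_step (a b : nat -> nat) (C eps : R) (J : nat) :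
  (forall k, 0 < a k)%N -> (forall k, a k <= b k)%N ->
  (forall k, b k <= a k.+1)%N -> 0 < eps -> 0 <= C ->
  (forall N (N_gt0 : (0 < N)%N) j,
    \sum_(0 <= k < j) mean (averaged_mean E N N_gt0)
      (fun p => (A' (a k) p - A' (b k) p) ^+ 2) <= C + (eps ^+ 2 / 16) ^+ 2 * j%:R) ->
  \sum_(0 <= k < J) mean E (fun x => (A (a k) x - A (b k) x) ^+ 2) <=
  (16 + 4 * (32 / eps ^+ 2 * C + 16)) / eps + eps * J%:R.
Proof.
move=> a0 ab ba eps0 C0 HC.
have eta0 : 0 < eps ^+ 2 / 16 by rewrite divr_gt0 // exprn_gt0.
have := sum_sigma_le a b C (eps ^+ 2 / 16) J a0 ab ba eta0 HC.
have -> : 16 * (eps ^+ 2 / 16) * J%:R ^+ 2 = (eps * J%:R) ^+ 2 by field.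
have -> : 2 / (eps ^+ 2 / 16) = 32 / eps ^+ 2 by field; rewrite gt_eqF.
set c := 16 + _ => bound.
have c0 : 0 <= c.
  by rewrite addr_ge0 // mulr_ge0 // addr_ge0 // mulr_ge0 // divr_ge0 // sqr_ge0.
set W := \sum_(0 <= k < J) _.
pose Sg x := \sum_(0 <= k < J) sigma (a k) (b k) x.
have DS : dom E Sg by exact: dom_sum.
(* As [u_k = (B_(a_k) - B_(b_k)) f] for the last [f], each [E u_k^2] equals [E (sigma_k f)]. *)
have WE : W = mean E (fun x => f ord_max x * Sg x).
  rewrite (_ : (fun x => _ * Sg x) = fun x =>
      \sum_(0 <= k < J) sigma (a k) (b k) x * f ord_max x); last first.
    by apply/funext => x; rewrite mulrC mulr_suml.
  rewrite mean_sum; last first.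
    by move=> k; apply: domM; [exact: sigma_dom|exact: system_dom sys _].
  apply: eq_bigr => k _; rewrite -mean_sigma; last exact: system_dom sys _.
  by congr mean; apply/funext => x; rewrite /u /A !multiple_average_weighted expr2.
have W2 : W ^+ 2 <= c * J%:R + (eps * J%:R) ^+ 2.
  rewrite WE; apply: le_trans bound; apply: mean_square_le => //.
  - exact: system_dom sys _.
  - exact: system_le1 sys _.
rewrite -[leLHS]/W; have ceps : 0 <= c / eps by rewrite divr_ge0 // ltW.
have eJ : 0 <= eps * J%:R by rewrite mulr_ge0 // ltW.
have [W0|W0] := leP 0 W; last by apply: le_trans (ltW W0) _; rewrite addr_ge0.
rewrite -(ler_pXn2r (ltn0Sn 1)) ?nnegrE ?addr_ge0 //.
apply: le_trans W2 _; rewrite sqrrD.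
have -> : c / eps * (eps * J%:R) = c * J%:R by field; rewrite gt_eqF.
have cJ : 0 <= c * J%:R by rewrite mulr_ge0.
by have := sqr_ge0 (c / eps); lra.
Qed.

End InductionStep.

(** * Induction on the number of transformations *)

Lemma bounded_oscillation_all (R : realType) (d : nat) : bounded_oscillation R d.
Proof.
elim: d => [|d IH] eps eps0.
  exists 0 => X E T S f _ a b a0 ab _ J.
  (* Without transformations every average of positive length is the empty product [1], so nothing
     oscillates. *)
  have A1 N x : (0 < N)%N -> multiple_average T f N x = 1.
    move=> N0; rewrite /multiple_average.
    under eq_bigr do rewrite big_ord0.
    by rewrite sumr_const_nat subn1 /= mulVf // pnatr_eq0 -lt0n.
  rewrite big1 ?add0r ?mulr_ge0 // => [|k _]; first exact: ltW.
  rewrite -[RHS](mean_cst E); congr mean; apply/funext => x.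
  by rewrite !A1 ?subrr ?expr0n // (leq_trans (a0 k)).
have eta0 : 0 < (eps ^+ 2 / 16) ^+ 2 by rewrite exprn_gt0 // divr_gt0 // exprn_gt0.
have [C HC] := IH _ eta0.
(* The absolute value supplies the nonnegative constant that [oscillation_step] asks for. *)
exists ((16 + 4 * (32 / eps ^+ 2 * `|C| + 16)) / eps).
move=> X E T S f sys a b a0 ab ba J; apply: (oscillation_step sys) => // N N0 j.
apply: le_trans (HC _ _ _ _ _ (reduced_system sys N N0) a b a0 ab ba j) _.
by rewrite lerD2r ler_norm.
Qed.

(** * Integration against a probability measure as a functional *)

Section ProbabilityMean.
Context {R : realType} {disp : measure_display} {X : measurableType disp}.
Variable mu : probability X R.

Let pdom (f : X -> R) :=
  measurable_fun [set: X] f /\ exists M, forall x, `|f x| <= M.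
Let pmean (f : X -> R) : R := \int[mu]_x f x.

Lemma bounded_measurable_integrable (f : X -> R) (M : R) :
  measurable_fun [set: X] f -> (forall x, `|f x| <= M) ->
  mu.-integrable [set: X] (EFin \o f).
Proof.
move=> mf fM; apply: measurable_bounded_integrable => //.
  by apply: (le_lt_trans (probability_le1 mu measurableT)); exact: ltry.
exists M; split; first by rewrite num_real.
by move=> K MK x _; exact: le_trans (fM x) (ltW MK).
Qed.

Let pdom_cst c : pdom (fun=> c).
Proof. by split; [exact: measurable_cst|exists `|c|]. Qed.

Let pdomD f g : pdom f -> pdom g -> pdom (fun x => f x + g x).
Proof.
move=> [mf [M fM]] [mg [K gK]]; split; first exact: measurable_funD.
by exists (M + K) => x; apply: le_trans (ler_normD _ _) _; exact: lerD.
Qed.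

Let pdomM f g : pdom f -> pdom g -> pdom (fun x => f x * g x).
Proof.
move=> [mf [M fM]] [mg [K gK]]; split; first exact: measurable_funM.
by exists (M * K) => x; rewrite normrM ler_pM.
Qed.

Let pmean1 : pmean (fun=> 1) = 1.
Proof. by rewrite /pmean Rintegral_cst //= mul1r; rewrite probability_setT. Qed.

Let pmeanD f g : pdom f -> pdom g ->
  pmean (fun x => f x + g x) = pmean f + pmean g.
Proof.
move=> [mf [M fM]] [mg [K gK]]; apply: RintegralD => //.
  exact: bounded_measurable_integrable fM.
exact: bounded_measurable_integrable gK.
Qed.

Let pmeanZ c f : pdom f -> pmean (fun x => c * f x) = c * pmean f.
Proof.
move=> [mf [M fM]]; apply: RintegralZl => //.
exact: bounded_measurable_integrable fM.
Qed.

Let pmean_ge0 f : pdom f -> (forall x, 0 <= f x) -> 0 <= pmean f.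
Proof. by move=> _ f0; apply: Rintegral_ge0 => x _. Qed.

Definition probability_mean : bounded_mean R X :=
  @BoundedMean R X pdom pmean pdom_cst pdomD pdomM pmean1 pmeanD pmeanZ pmean_ge0.

Lemma probability_mean_preserves T :
  measure_preserving mu T -> preserves probability_mean T.
Proof.
move=> [mT muT] f [mf [M fM]].
have mfT : measurable_fun [set: X] (f \o T) by exact: measurableT_comp.
split; first by split => //; exists M => x; exact: fM.
rewrite /= /pmean /Rintegral; congr fine.
rewrite [RHS](eq_measure_integral (pushforward mu T)) /=.
  rewrite integral_pushforward //; first exact/measurable_EFinP.
  exact: (bounded_measurable_integrable (f \o T) M mfT (fun x => fM _)).
by move=> A mA _; rewrite /pushforward muT.
Qed.

(** Invariance under [S] follows from that under [T]: [E (f o S) = E (f o S o T) = E f]. *)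
Lemma probability_mean_automorphism T S :
  measure_preserving mu T -> cancel T S -> cancel S T ->
  measurable_fun [set: X] S -> automorphism probability_mean T S.
Proof.
move=> pT TS ST mS; split => //; first exact: probability_mean_preserves.
move=> f [mf [M fM]].
have Df : dom probability_mean (f \o S).
  by split; [exact: measurableT_comp|exists M => x; exact: fM].
split => //; rewrite -(probability_mean_preserves T pT _ Df).2.
by congr mean; apply/funext => x; rewrite /= TS.
Qed.

Lemma ae_preserving T (P : X -> Prop) n : measure_preserving mu T ->
  (\forall x \ae mu, P x) -> \forall x \ae mu, P (iter n T x).
Proof.
move=> [mT muT] [A [mA A0 PA]]; elim: n => [|n [B [mB B0 PB]]]; first by exists A.
exists (T @^-1` B); split.
- by rewrite -[_ @^-1` _]setTI; exact: mT.
- by rewrite -B0; exact: muT.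
- by move=> x /= nP; apply: PB => /=; rewrite -iterSr.
Qed.

(** [g] stands for the difference of the given averages, bounded only almost everywhere, and [h] for
    its truncated counterpart, to which the functional applies. *)
Lemma Lnorm2_lt (g h : X -> R) (M eps : R) : 0 < eps ->
  measurable_fun [set: X] g -> measurable_fun [set: X] h ->
  (forall x, `|h x| <= M) -> (\forall x \ae mu, g x = h x) ->
  mean probability_mean (fun x => h x ^+ 2) < eps ^+ 2 ->
  ('N[mu]_2%:E[EFin \o g] < eps%:E)%E.
Proof.
move=> eps0 mg mh hM gh hlt; rewrite unlock /=.
have -> : (\int[mu]_x `|(g x)%:E| `^ 2 = (\int[mu]_x (h x ^+ 2))%:E)%E.
  have mh2 : measurable_fun [set: X] (fun x => h x ^+ 2).
    exact: measurable_funX.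
  (* [fine] sends an infinite integral to [0], so finiteness has to be derived from [|h| <= M]. *)
  rewrite /Rintegral fineK; last first.
    apply: integrable_fin_num => //.
    apply: (bounded_measurable_integrable (fun x => h x ^+ 2) (M ^+ 2)) => // x.
    by rewrite normrX lerXn2r ?nnegrE // (le_trans _ (hM x)).
  rewrite (_ : (fun x => _) = fun x => (g x ^+ 2)%:E); last first.
    apply/funext => x; rewrite poweR_EFin -[2]/(2%:R) powR_mulrn //.
    by rewrite real_normK ?num_real.
  apply: ae_eq_integral => //.
  - by apply/measurable_EFinP; exact: measurable_funX.
  - exact/measurable_EFinP.
  - by apply: filterS gh => x /= -> _.
rewrite poweR_EFin lte_fin powR12_sqrt; last first.
  by apply: Rintegral_ge0 => x _; exact: sqr_ge0.
rewrite -(gtr0_norm eps0) -sqrtr_sqr ltr_sqrt ?exprn_gt0 //.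
Qed.

End ProbabilityMean.

(** * From the oscillation bound to two close consecutive averages *)

Lemma measurable_multiple_average (R : realType) (disp : measure_display)
    (X : measurableType disp) (d : nat) (T : 'I_d -> X -> X)
    (f : 'I_d -> X -> R) (N : nat) :
  (forall i, measurable_fun [set: X] (T i)) ->
  (forall i, measurable_fun [set: X] (f i)) ->
  measurable_fun [set: X] (multiple_average T f N).
Proof.
move=> mT mf; apply: measurable_funM; first exact: measurable_cst.
apply: measurable_sum => n; apply: measurable_prod => i _.
apply: (measurableT_comp (mf i)).
by elim: n => [|n IH]; [exact: measurable_id|exact: measurableT_comp (mT i) IH].
Qed.

(** With [K = J + 1], if all [J] consecutive differences had norm at least [eps], their squares
    would sum to at least [eps^2 J]. The oscillation bound with slope [eps^2 / 2] forbids this once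
    [C < eps^2 / 2 * J]. *)
Theorem theorem1p2 (R : realType) (d : nat) (eps : R) :
  (0 < d)%N -> 0 < eps ->
  exists K : nat,
    forall (disp : measure_display) (X : measurableType disp)
      (mu : probability X R) (T : 'I_d -> X -> X) (f : 'I_d -> X -> R),
    (forall i : 'I_d, measure_preserving mu (T i)) ->
    (forall i : 'I_d, measurably_invertible (T i)) ->
    (forall (i j : 'I_d) (x : X), T i (T j x) = T j (T i x)) ->
    (forall i : 'I_d, measurable_fun [set: X] (f i)) ->
    (forall i : 'I_d, ('N[mu]_(+oo)[EFin \o f i] <= 1)%E) ->
    forall N : nat -> nat,
    (forall i : nat, (1 <= i <= K)%N -> (0 < N i)%N) ->
    (forall i : nat, (1 <= i < K)%N -> (N i < N i.+1)%N) ->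
    exists2 i : nat, (1 <= i < K)%N &
      ('N[mu]_2%:E[EFin \o (multiple_average T f (N i)
                               \- multiple_average T f (N i.+1))%R] < eps%:E)%E.
Proof.
move=> _ eps0.
have eps2 : 0 < eps ^+ 2 / 2 by rewrite divr_gt0 // exprn_gt0.
have [C HC] := bounded_oscillation_all R d _ eps2.
have [J CJ] : exists J : nat, C < eps ^+ 2 / 2 * J%:R.
  exists (Num.bound `|C / (eps ^+ 2 / 2)|).
  rewrite mulrC -ltr_pdivrMr //; apply: le_lt_trans (ler_norm _) _.
  exact: archi_boundP.
exists J.+1 => disp X mu T f pT iT cT mf f1 N N0 NS.
have /choice[S HS] := iT.
(* Truncation to [[-1, 1]]: [commuting_system] asks for a pointwise bound, whereas [f] is bounded
   only almost everywhere. *)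
pose g i x := Num.max (-1) (Num.min 1 (f i x)).
have mg i : measurable_fun [set: X] (g i).
  apply: measurable_maxr; first exact: measurable_cst.
  by apply: measurable_minr; first exact: measurable_cst.
have g1 i x : `|g i x| <= 1.
  by rewrite ler_norml /g le_max lexx ge_max ge_min lexx (le_trans (lerN10 _) ler01).
(* A countable union of null sets: off a single one, truncation changes nothing along any of the
   orbits. *)
have fg : \forall x \ae mu, forall n i, f i (iter n (T i) x) = g i (iter n (T i) x).
  apply: ae_foralln => n; apply: filter_forall => i.
  apply: (ae_preserving mu (T i) (fun x => f i x = g i x)) => //.
  (* The norm of exponent [+oo] is the essential supremum only on a space of positive measure, which
     [probability_setT] provides. *)
  have := f1 i; rewrite unlock /= probability_setT lte01 => /ess_supP.
  apply: filterS => x /=; rewrite lee_fin ler_norml => /andP[h1 h2].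
  by rewrite /g (min_idPr h2) (max_idPr h1).
have sys : commuting_system (probability_mean mu) T S g.
  split => // i.
    by case: (HS i) => TS ST mS; exact: probability_mean_automorphism.
  by split => //; exists 1.
(* [N] is controlled only up to [K], while the oscillation bound takes infinite sequences; [N']
   extends it, still positive and nondecreasing from index [1] on. *)
pose N' k := if (k <= J.+1)%N then N k else (N J.+1 + k)%N.
have N'0 k : (0 < k)%N -> (0 < N' k)%N.
  rewrite /N'; case: (leqP k J.+1) => kJ k0; first by apply: N0; rewrite k0.
  by rewrite addn_gt0 k0 orbT.
have N'S k : (0 < k)%N -> (N' k <= N' k.+1)%N.
  move=> k0; rewrite /N'; case: (ltngtP k J.+1) => [kJ|kJ|->].
  - by apply: ltnW; apply: NS; rewrite k0.
  - by rewrite leq_add2l.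
  - by rewrite leq_addr.
apply: contrapT => noi.
(* Adjacent intervals, [b k = a k.+1]; indices are shifted by one since the given sequence starts at
   [1]. *)
have := HC X _ T S g sys (fun k => N' k.+1) (fun k => N' k.+2)
  (fun k => N'0 k.+1 isT) (fun k => N'S k.+1 isT) (fun k => leqnn _) J.
apply/negP; rewrite -ltNge; apply: (@lt_le_trans _ _ (eps ^+ 2 * J%:R)).
  lra.
rewrite mulr_natr -[in leLHS](subn0 J) -sumr_const_nat.
apply: ler_sum_nat => k /andP[_ kJ]; rewrite leNgt; apply/negP => small; apply: noi.
exists k.+1; first by rewrite ltnS.
have N'E i : (i <= J.+1)%N -> N' i = N i by rewrite /N' => ->.
rewrite !N'E // in small; last exact: ltnW.
apply: (Lnorm2_lt mu _ _ 2 eps eps0 _ _ _ _ small).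
- by apply: measurable_funB; apply: measurable_multiple_average => // i; case: (pT i).
- by apply: measurable_funB; apply: measurable_multiple_average => // i; case: (pT i).
- move=> x; apply: multiple_average_sub_le2 sys _ _ _ _ _.
    by apply: N0; rewrite /= ltnW.
  by apply: ltnW; apply: NS.
- apply: filterS fg => x fg /=; rewrite /multiple_average.
  by do 2![congr (_ - _)|congr (_ * _); apply: eq_bigr => n _; apply: eq_bigr => i _].
Qed.
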